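(* Let $a, c$ be nonnegative integers. Then there exists a nonnegative integer $b$ such that $\mathcal{G}_{\mathcal{R}}(a,b) = c$.
   Context: A position is an unordered pair $(a,b)$ of nonnegative integers (pile sizes). $\mathcal{R}$-Wythoff: a move either removes a positive number of tokens from the larger pile (or from either pile if both piles have equal size), or removes the same positive number of tokens from both piles. $\mathcal{G}_{\mathcal{R}}$ is the Sprague-Grundy function of $\mathcal{R}$-Wythoff: $\mathcal{G}_{\mathcal{R}}(p)=\mathrm{mex}\{\mathcal{G}_{\mathcal{R}}(q): q \text{ reachable from } p \text{ in one move}\}$, where $\mathrm{mex}(S)$ is the least nonnegative integer not in $S$ and $\mathrm{mex}\{\}=0$. *)

(* Defs.v *)
From mathcomp Require Import all_boot.
Set Implicit Arguments.
Unset Strict Implicit.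
Unset Printing Implicit Defensive.

Lemma mex_exists (s : seq nat) : exists n, n \notin s.
Proof.
have le_sumn x : x \in s -> x <= sumn s.
  elim: s => //= y s IHs; rewrite inE => /predU1P[->|/IHs xs].
    exact: leq_addr.
  exact: leq_trans xs (leq_addl _ _).
by exists (sumn s).+1; apply/negP => /le_sumn; rewrite ltnn.
Qed.

Definition mex (s : seq nat) : nat := ex_minn (mex_exists s).

(* An unordered pair of pile sizes is represented by either of its two
   orderings; moves are symmetric under swapping, so the Grundy value does not
   depend on the ordering (grundy_R_sym below). *)
Definition position : Type := (nat * nat)%type.

(* The positions reachable in one move of R-Wythoff. When the piles are equal,
   both of the first two lists contribute. *)
Definition R_options (p : position) : seq position :=
  let: (a, b) := p in
  (if b <= a then [seq (a - k, b) | k <- iota 1 a] else [::])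
  ++ (if a <= b then [seq (a, b - k) | k <- iota 1 b] else [::])
  ++ [seq (a - k, b - k) | k <- iota 1 (minn a b)].

(* The fuel n only serves termination: any n > a + b gives the same value,
   because every move decreases the total number of tokens. *)
Fixpoint grundy_R_fuel (n : nat) (p : position) : nat :=
  if n is n'.+1 then mex [seq grundy_R_fuel n' q | q <- R_options p] else 0.

Definition grundy_R (p : position) : nat := grundy_R_fuel (p.1 + p.2).+1 p.

Lemma R_options_decr (p q : position) :
  q \in R_options p -> q.1 + q.2 < p.1 + p.2.
Proof.
case: p => a b; rewrite /R_options !mem_cat => /or3P[].
- case: ifP => // _ /mapP[k]; rewrite mem_iota add1n ltnS => /andP[k0 ka] -> /=.
  by rewrite ltn_add2r -subn_gt0 subKn.
- case: ifP => // _ /mapP[k]; rewrite mem_iota add1n ltnS => /andP[k0 kb] -> /=.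
  by rewrite ltn_add2l -subn_gt0 subKn.
- move=> /mapP[k]; rewrite mem_iota add1n ltnS leq_min => /and3P[k0 ka kb] -> /=.
  by rewrite -addSn leq_add ?leq_subr // -subn_gt0 subKn.
Qed.

Lemma grundy_R_fuelE (n : nat) (p : position) :
  p.1 + p.2 < n -> grundy_R_fuel n p = grundy_R p.
Proof.
suff H m k q : q.1 + q.2 < m -> q.1 + q.2 < k ->
    grundy_R_fuel m q = grundy_R_fuel k q by move=> pn; apply: H.
elim: m k q => // m IHm [//|k] q qm qk /=; congr mex.
by apply/eq_in_map => r /R_options_decr rq; apply: IHm; apply: leq_trans rq _.
Qed.

Lemma grundy_RE (p : position) :
  grundy_R p = mex [seq grundy_R q | q <- R_options p].
Proof.
rewrite {1}/grundy_R /=; congr mex.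
by apply/eq_in_map => q /R_options_decr qp; apply: grundy_R_fuelE.
Qed.

Lemma eq_mex (s t : seq nat) : s =i t -> mex s = mex t.
Proof.
move=> st; rewrite /mex; apply: eq_ex_minn => n; by rewrite st.
Qed.

Lemma R_options_swap (a b x y : nat) :
  (x, y) \in R_options (a, b) -> (y, x) \in R_options (b, a).
Proof.
rewrite /R_options !mem_cat => /or3P[].
- by case: ifP => // _ /mapP[k kI [-> ->]]; rewrite orbCA; apply/orP; left;
    apply/mapP; exists k.
- by case: ifP => // _ /mapP[k kI [-> ->]]; apply/orP; left; apply/mapP; exists k.
- move=> /mapP[k kI [-> ->]]; apply/or3P; apply: Or33.
  by apply/mapP; exists k; rewrite // minnC.
Qed.

Lemma grundy_R_sym (a b : nat) : grundy_R (a, b) = grundy_R (b, a).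
Proof.
have [n] := ubnP (a + b); elim: n a b => // n IHn a b abn.
rewrite !grundy_RE; apply: eq_mex => v.
have le q : q \in R_options (a, b) -> q.1 + q.2 < n.
  by move=> /R_options_decr /leq_trans; apply.
apply/mapP/mapP => -[[x y] xyI ->].
- by exists (y, x); [apply: R_options_swap | apply: IHn (le _ xyI)].
- have yxI := R_options_swap xyI.
  by exists (y, x) => //; rewrite (IHn _ _ (le _ yxI)).
Qed.

(* Main.v *)
Require Import Defs.
From mathcomp Require Import all_boot.

(** In row [a], the options of [(a, b)] with [a <= b] include every [(a, b')]
with [b' < b], so the Grundy values at [b >= a] are pairwise distinct. If row
[a] missed the value [c], each [b >= a] would satisfy [G (a, b) < c], or else
have a diagonal option [(j, b - a + j)], [j < a], of value [c]. By injectivity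
of the rows, the first case occurs for at most [c] values of [b] and the second
for at most one value of [b] per [j < a]: too few for infinitely many [b]. *)

Lemma mex_notin (s : seq nat) : mex s \notin s.
Proof. by rewrite /mex; case: ex_minnP. Qed.

Lemma mem_ltn_mex (s : seq nat) (n : nat) : n < mex s -> n \in s.
Proof.
by rewrite /mex; case: ex_minnP => m _ mP; apply: contraTT => /mP; rewrite leqNgt.
Qed.

Lemma grundy_R_option_neq (p q : position) :
  q \in R_options p -> grundy_R q != grundy_R p.
Proof.
move=> qp; apply: contraNneq (mex_notin [seq grundy_R r | r <- R_options p]).
by rewrite -grundy_RE => <-; apply: map_f.
Qed.

Lemma grundy_R_row_inj (a i j : nat) :
  a <= i -> a <= j -> grundy_R (a, i) = grundy_R (a, j) -> i = j.
Proof.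
have lt_neq k l : k < l -> a <= l -> grundy_R (a, k) != grundy_R (a, l).
  move=> kl al; apply: grundy_R_option_neq.
  rewrite /R_options !mem_cat al; apply/or3P/Or32/mapP; exists (l - k).
    by rewrite mem_iota subn_gt0 kl add1n ltnS leq_subr.
  by rewrite subKn // ltnW.
move=> ai aj /eqP; case: (ltngtP i j) => // [ij|ji].
  by rewrite (negbTE (lt_neq _ _ ij aj)).
by rewrite eq_sym (negbTE (lt_neq _ _ ji ai)).
Qed.

(** Since [c] lies below the mex, some option has value [c]. It is not in row [a]; shrinking only
    the first pile requires [i = 0], and then symmetry brings the option back to row [a]. A diagonal
    move remains. *)
Lemma grundy_R_gt_diag (a c i : nat) :
    (forall b, b <= a + i -> grundy_R (a, b) != c) -> c < grundy_R (a, a + i) ->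
  has (fun j => grundy_R (j, i + j) == c) (iota 0 a).
Proof.
move=> row_neq; rewrite grundy_RE => /mem_ltn_mex /mapP[q].
rewrite /R_options !mem_cat => /or3P[].
- case: ifP => // le_a /mapP[k _ ->] /eqP.
  have -> : i = 0 by apply/eqP; rewrite -leqn0 -(leq_add2l a) addn0.
  rewrite addn0 grundy_R_sym eq_sym (negbTE (row_neq _ _)) //.
  exact: leq_trans (leq_subr _ _) (leq_addr _ _).
- case: ifP => // _ /mapP[k _ ->] /eqP.
  by rewrite eq_sym (negbTE (row_neq _ (leq_subr _ _))).
- rewrite (minn_idPl (leq_addr i a)) => /mapP[k].
  rewrite mem_iota add1n ltnS => /andP[k0 ka] -> ->.
  apply/hasP; exists (a - k); last by rewrite addnC addnBAC.
  by rewrite mem_iota /= add0n -subn_gt0 subKn.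
Qed.

Theorem theorem2p7 (a c : nat) : exists b : nat, grundy_R (a, b) = c.
Proof.
(* The range contains [a + i] for [c + a + 1] values of [i], one more than the codes available to
   [f] below. *)
have [/hasP[b _ /eqP]|/hasPn row_neq] :=
  boolP (has (fun b => grundy_R (a, b) == c) (iota 0 (a + (c + a).+1))).
  by exists b.
pose diag i j := grundy_R (j, i + j) == c.
(* Pigeonhole code: small Grundy values fill [[0, c)], and the first row [j < a] whose diagonal
   option has value [c] is coded as [c + j]. *)
pose f i := if grundy_R (a, a + i) < c then grundy_R (a, a + i)
            else c + find (diag i) (iota 0 a).
have diagP i : i < (c + a).+1 -> c <= grundy_R (a, a + i) ->
    has (diag i) (iota 0 a).
  move=> lt_i le_c; have row_neq_i b : b <= a + i -> grundy_R (a, b) != c.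
    move=> le_b; apply: row_neq; rewrite mem_iota /=.
    by apply: leq_ltn_trans le_b _; rewrite ltn_add2l.
  by apply: grundy_R_gt_diag => //; rewrite ltn_neqAle eq_sym row_neq_i.
have find_lt i : has (diag i) (iota 0 a) -> find (diag i) (iota 0 a) < a.
  by rewrite has_find size_iota.
have f_lt (i : 'I_(c + a).+1) : f i < c + a.
  rewrite /f; case: (ltnP _ c) => [lt_c|le_c].
    exact: leq_trans lt_c (leq_addr _ _).
  by rewrite ltn_add2l find_lt ?diagP.
suff f_inj : injective (fun i => Ordinal (f_lt i)).
  by have := leq_card _ f_inj; rewrite !card_ord ltnn.
move=> i j [fij]; apply: val_inj; move: fij; rewrite /= /f.
case: ltnP => [lt_i|le_i]; case: ltnP => [lt_j|le_j].
- by move/(grundy_R_row_inj _ _ _ (leq_addr _ _) (leq_addr _ _))/addnI.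
- by move=> eq_c; rewrite eq_c ltnNge leq_addr in lt_i.
- by move=> eq_c; rewrite -eq_c ltnNge leq_addr in lt_j.
- move/addnI => eq_find.
  (* Both diagonal options lie in the same row and have value [c], so injectivity of that row makes
     them equal. *)
  have di := diagP _ (ltn_ord i) le_i; have dj := diagP _ (ltn_ord j) le_j.
  have := nth_find 0 di; have := nth_find 0 dj.
  rewrite -eq_find nth_iota ?find_lt // /diag => /eqP gj /eqP gi; move: (etrans gi (esym gj)).
  by move=> /(grundy_R_row_inj _ _ _ (leq_addl _ _) (leq_addl _ _))/addIn.
Qed.
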